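(* Let $X$ and $Y$ be Banach spaces. Assume that $X$ is almost square. (i) If $H\subseteq K(Y,X)$ is a closed subspace with $Y^*\otimes X\subset H$, then $H$ is almost square. (ii) If $H\subseteq K(Y^*,X)$ is a closed subspace with $Y\otimes X\subset H$, then $H$ is almost square.
   Context: All Banach spaces are real and non-zero. $B_X$ and $S_X$ denote the closed unit ball and the unit sphere of $X$. $K(Y,X)$ is the Banach space of compact linear operators from $Y$ to $X$ with the operator norm. $Y^*\otimes X$ is viewed inside $K(Y,X)$ by letting $y^*\otimes x$ act as $y\mapsto y^*(y)\,x$, and $Y\otimes X$ is viewed inside $K(Y^*,X)$ by letting $y\otimes x$ act as $y^*\mapsto y^*(y)\,x$. A Banach space $X$ is almost square (ASQ) if for every $x_1,\ldots,x_k\in S_X$ there exists a sequence $\{y_n\}$ in $B_X$ such that $\|y_n\|\to 1$ and $\|x_i\pm y_n\|\to 1$ for every $i\in\{1,\ldots,k\}$. *)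

(* Defs.v *)
From HB Require Import structures.
From mathcomp Require Import all_boot all_order all_algebra.
From mathcomp Require Import all_classical all_reals.
From mathcomp Require Import topology normedtype sequences.

Set Implicit Arguments.
Unset Strict Implicit.
Unset Printing Implicit Defensive.

Import Order.TTheory GRing.Theory Num.Theory.
Import numFieldNormedType.Exports.

Local Open Scope classical_set_scope.
Local Open Scope ring_scope.

Definition unit_ball (R : realType) (V : normedModType R) : set V :=
  [set x | `|x| <= 1].

Arguments unit_ball {R} V _.

Section BoundedOperators.
Context {R : realType} (V W : normedModType R).

Definition continuous_linear : {pred V -> W} :=
  mem [set f : V -> W | linear f /\ continuous f].

Record bounded_op := BoundedOp {
  bounded_op_fun :> V -> W;
  bounded_opP : bounded_op_fun \in continuous_linear }.

HB.instance Definition _ := [isSub of bounded_op for bounded_op_fun].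
HB.instance Definition _ := [Choice of bounded_op by <:].

Lemma continuous_linear_submod_closed : submod_closed continuous_linear.
Proof.
split=> [|a f g].
  rewrite inE; split=> [b x y|]; first by rewrite scaler0 addr0.
  exact: cst_continuous.
rewrite !inE => -[lf cf] [lg cg]; split=> [b x y|x].
  rewrite !fctE lf lg !scalerDr !scalerA [a * b]mulrC.
  by rewrite -!addrA; congr (_ + _); rewrite addrCA.
by apply: cvgD; [apply: cvgZl_tmp; exact: cf|exact: cg].
Qed.

HB.instance Definition _ :=
  GRing.isSubmodClosed.Build R (V -> W) continuous_linear
    continuous_linear_submod_closed.
HB.instance Definition _ := [SubChoice_isSubLmodule of bounded_op by <:].

Section Theory.
Variable f : bounded_op.

Lemma bounded_op_linear : linear f.
Proof. by have := bounded_opP f; rewrite inE => -[]. Qed.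

Lemma bounded_op_continuous : continuous f.
Proof. by have := bounded_opP f; rewrite inE => -[]. Qed.

HB.instance Definition _ :=
  GRing.isLinear.Build R V W _ (bounded_op_fun f) bounded_op_linear.

End Theory.

Definition opnorm (f : bounded_op) : R := sup [set `|f x| | x in unit_ball V].

Lemma opnorm_has_ubound (f : bounded_op) :
  has_ubound [set `|f x| | x in unit_ball V].
Proof.
have /linear_bounded_continuous/bounded_funP/(_ 1)[M fM] :=
  @bounded_op_continuous f.
by exists M => _ [x x1 <-]; exact: fM.
Qed.

Lemma opnorm_ub (f : bounded_op) x : `|x| <= 1 -> `|f x| <= opnorm f.
Proof.
by move=> x1; apply: ub_le_sup; [exact: opnorm_has_ubound|exists x].
Qed.

Lemma opnorm_le (f : bounded_op) c :
  (forall x, `|x| <= 1 -> `|f x| <= c) -> opnorm f <= c.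
Proof.
move=> fc; apply: ge_sup; last by move=> _ [x x1 <-]; exact: fc.
by exists `|f 0|; exists 0 => //; rewrite /unit_ball /= normr0.
Qed.

Lemma opnorm_ge0 (f : bounded_op) : 0 <= opnorm f.
Proof. by rewrite (le_trans _ (@opnorm_ub f 0 _))// normr0. Qed.

Lemma le_opnorm (f : bounded_op) x : `|f x| <= opnorm f * `|x|.
Proof.
have [->|x0] := eqVneq x 0; first by rewrite linear0 !normr0 mulr0.
have nx : 0 < `|x| by rewrite normr_gt0.
have : `|f (`|x|^-1 *: x)| <= opnorm f.
  by apply: opnorm_ub; rewrite normrZ normfV normr_id mulVf ?gt_eqF.
rewrite linearZ /= normrZ normfV normr_id.
by rewrite ler_pdivrMl// mulrC.
Qed.

Lemma opnormD (f g : bounded_op) : opnorm (f + g) <= opnorm f + opnorm g.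
Proof.
apply: opnorm_le => x x1; rewrite (le_trans (ler_normD _ _))//.
by rewrite lerD// opnorm_ub.
Qed.

Lemma opnormZ a (f : bounded_op) : opnorm (a *: f) = `|a| * opnorm f.
Proof.
have le b (g : bounded_op) : opnorm (b *: g) <= `|b| * opnorm g.
  by apply: opnorm_le => x x1; rewrite normrZ ler_wpM2l// opnorm_ub.
apply/eqP; rewrite eq_le le /=.
have [->|a0] := eqVneq a 0; first by rewrite normr0 mul0r opnorm_ge0.
rewrite -ler_pdivlMl ?normr_gt0//.
have := le a^-1 (a *: f).
by rewrite scalerA mulVf// scale1r normfV.
Qed.

Lemma opnorm0_eq0 (f : bounded_op) : opnorm f = 0 -> f = 0.
Proof.
move=> f0; apply/val_inj/funext => x /=; apply/eqP.
by have := le_opnorm f x; rewrite f0 mul0r normr_le0.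
Qed.

HB.instance Definition _ :=
  Lmodule_isNormed.Build R bounded_op opnormD opnormZ opnorm0_eq0.

Lemma norm_bounded_op (f : bounded_op) : `|f| = opnorm f.
Proof. by []. Qed.

Lemma bounded_opD (f g : bounded_op) x : (f + g) x = f x + g x.
Proof. by []. Qed.

Lemma bounded_opN (f : bounded_op) x : (- f) x = - f x.
Proof. by []. Qed.

Lemma bounded_opZ a (f : bounded_op) x : (a *: f) x = a *: f x.
Proof. by []. Qed.

End BoundedOperators.
Arguments continuous_linear {R} V W.

Notation dual V := (bounded_op V (GRing.regular _)).

Section Subspace.
Context {R : realType} {V : normedModType R} (H : submodClosed V).

Record subnormed := SubNormed {
  subnormed_val : V;
  subnormed_valP : subnormed_val \in H }.

HB.instance Definition _ := [isSub of subnormed for subnormed_val].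
HB.instance Definition _ := [Choice of subnormed by <:].
HB.instance Definition _ := [SubChoice_isSubLmodule of subnormed by <:].

Let norm (u : subnormed) : R := `|subnormed_val u|.

Let normD u v : norm (u + v) <= norm u + norm v.
Proof. exact: ler_normD. Qed.

Let normZ a u : norm (a *: u) = `|a| * norm u.
Proof. exact: normrZ. Qed.

Let norm_eq0 u : norm u = 0 -> u = 0.
Proof. by move=> /normr0_eq0 u0; exact: val_inj. Qed.

HB.instance Definition _ :=
  Lmodule_isNormed.Build R subnormed normD normZ norm_eq0.

Lemma norm_subnormed (u : subnormed) : `|u| = `|subnormed_val u|.
Proof. by []. Qed.

Lemma subnormed_val_linear : linear subnormed_val.
Proof. by []. Qed.

HB.instance Definition _ :=
  GRing.isLinear.Build R subnormed V _ subnormed_val subnormed_val_linear.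

End Subspace.

Section CompactOperators.
Context {R : realType} (V W : normedModType R).

Definition compact_operator : {pred bounded_op V W} :=
  mem [set T : bounded_op V W | precompact (T @` unit_ball V)].

Lemma compact_operator_submod_closed : submod_closed compact_operator.
Proof.
split=> [|a f g]; rewrite !inE.
  exists [set 0].
    by move=> _ [x _ <-].
  split; first exact: compact_set1.
  by apply: compact_closed; [exact: norm_hausdorff|exact: compact_set1].
move=> [A fA [cA _]] [B gB [cB _]].
pose C := (fun z : W * W => a *: z.1 + z.2) @` (A `*` B).
have cC : compact C.
  apply: continuous_compact; last exact: compact_setX.
  apply: continuous_subspaceT => z.
  apply: cvgD; last exact: cvg_snd.
  by apply: cvgZl_tmp; exact: cvg_fst.
exists C.
  move=> _ [x x1 <-]; exists (f x, g x) => //.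
  by split; [apply: fA|apply: gB]; exists x.
by split=> //; apply: compact_closed => //; exact: norm_hausdorff.
Qed.

HB.instance Definition _ :=
  GRing.isSubmodClosed.Build R (bounded_op V W) compact_operator
    compact_operator_submod_closed.

End CompactOperators.
Arguments compact_operator {R} V W.

Notation compact_op V W := (subnormed (compact_operator V W)).

Section ElementaryTensor.
Context {R : realType} {V W : normedModType R}.
Variables (f : dual V) (x : W).

Definition tensor_fun (v : V) : W := f v *: x.

Lemma tensor_fun_continuous_linear : tensor_fun \in continuous_linear V W.
Proof.
rewrite inE; split=> [a u v|v]; rewrite /tensor_fun.
  by rewrite linearP scalerDl scalerA.
by apply: cvgZr_tmp; exact: bounded_op_continuous.
Qed.

Definition tensor_bounded_op : bounded_op V W :=
  BoundedOp tensor_fun_continuous_linear.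

Lemma tensor_compact : tensor_bounded_op \in compact_operator V W.
Proof.
rewrite inE.
pose C := (fun c : R => c *: x) @` `[- `|f|, `|f|]%classic.
have cC : compact C.
  apply: continuous_compact; last exact: segment_compact.
  by apply: continuous_subspaceT => c; apply: cvgZr_tmp; exact: cvg_id.
exists C.
  move=> _ [v v1 <-]; exists (f v) => //=.
  by rewrite in_itv /= -ler_norml; exact: opnorm_ub.
by split=> //; apply: compact_closed => //; exact: norm_hausdorff.
Qed.

Definition tensor : compact_op V W := SubNormed tensor_compact.

Lemma tensorE v : subnormed_val tensor v = f v *: x.
Proof. by []. Qed.

End ElementaryTensor.

Section Evaluation.
Context {R : realType} {V : normedModType R} (v : V).

Definition evaluation_fun (f : dual V) : R^o := f v.

Lemma evaluation_continuous_linear :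
  evaluation_fun \in continuous_linear (dual V) R^o.
Proof.
have lin : linear evaluation_fun by [].
rewrite inE; split=> //.
pose aux := GRing.isLinear.Build R (dual V) R^o _ evaluation_fun lin.
pose ev : {linear dual V -> R^o} := HB.pack evaluation_fun aux.
apply: (@bounded_linear_continuous _ _ _ ev); apply/bounded_funP => r.
exists (r * `|v|) => f fr.
by rewrite (le_trans (le_opnorm _ _))// ler_wpM2r.
Qed.

Definition evaluation : dual (dual V) :=
  BoundedOp evaluation_continuous_linear.

Lemma evaluationE (f : dual V) : evaluation f = f v.
Proof. by []. Qed.

End Evaluation.

(* the algebraic tensor products [V^* \otimes W] and [V \otimes W], as sets of
   finite sums of elementary tensors *)
Definition dual_tensor_product (R : realType) (V W : normedModType R) :
    set (compact_op V W) :=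
  [set T | exists (n : nat) (f : 'I_n -> dual V) (x : 'I_n -> W),
     T = \sum_(i < n) tensor (f i) (x i)].

Definition tensor_product (R : realType) (V W : normedModType R) :
    set (compact_op (dual V) W) :=
  [set T | exists (n : nat) (v : 'I_n -> V) (x : 'I_n -> W),
     T = \sum_(i < n) tensor (evaluation (v i)) (x i)].

Arguments dual_tensor_product {R} V W _.
Arguments tensor_product {R} V W _.

(* The case k = 0 only says that V is non-zero. *)
Definition almost_square (R : realType) (V : normedModType R) : Prop :=
  forall (k : nat) (x : 'I_k -> V), (forall i, `|x i| = 1) ->
  exists y : nat -> V,
    [/\ forall n, `|y n| <= 1,
        `|y n| @[n --> \oo] --> (1 : R) &
        forall i, `|x i + y n| @[n --> \oo] --> (1 : R) /\
                  `|x i - y n| @[n --> \oo] --> (1 : R)].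

(* Main.v *)
(* Fix [g] of norm 1 with every [g \otimes x] in [H], and [T_1, ..., T_k] of norm
   1 in [H].  A finite net of the precompact sets [T_i(B)] reduces the problem
   to finitely many points [z] of [B_X]; by convexity the almost square
   property gives [y] of norm almost 1 with [|z + a y| <= 1 + e] for all of them
   and all [|a| <= 1].  Then [S = g \otimes y] satisfies [|T_i + S| <= 1 + 2e]
   and [|T_i - S| <= 1 + 2e], and the lower bounds follow from
   [|T_i + S| + |T_i - S| >= 2 |T_i| = 2].
   That some [g] exists follows from the Hahn-Banach theorem, obtained from the
   fact that minimal sublinear functionals are linear; for (ii), a non-zero
   functional makes some evaluation non-zero. *)
Require Import Defs.
From HB Require Import structures.
From mathcomp Require Import all_boot all_order all_algebra.
From mathcomp Require Import all_classical all_reals.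
From mathcomp Require Import topology normedtype sequences.
From mathcomp Require Import lra.
Set Implicit Arguments.
Unset Strict Implicit.
Unset Printing Implicit Defensive.
Import Order.TTheory GRing.Theory Num.Theory.
Import numFieldNormedType.Exports.
Local Open Scope classical_set_scope.
Local Open Scope ring_scope.

(** * Sublinear functionals and the Hahn-Banach theorem *)

Section Sublinear.
Context {R : realType} {V : lmodType R}.
Implicit Types (p q : V -> R) (x y : V).

Definition sublinear p :=
  (forall x y, p (x + y) <= p x + p y) /\
  (forall t x, 0 <= t -> p (t *: x) <= t * p x).

Lemma sublinear0 p : sublinear p -> p 0 = 0.
Proof.
move=> [pD pZ]; apply/eqP; rewrite eq_le; apply/andP; split.
  by rewrite -(scale0r (0 : V)) (le_trans (pZ _ _ _))// mul0r.
by have := pD 0 0; rewrite addr0; lra.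
Qed.

Lemma sublinearN p x : sublinear p -> - p (- x) <= p x.
Proof.
by move=> sp; have := sp.1 x (- x); rewrite subrr sublinear0//; lra.
Qed.

Lemma sublinearZ p t x : sublinear p -> 0 <= t -> p (t *: x) = t * p x.
Proof.
move=> sp; rewrite le_eqVlt => /predU1P[<-|t0].
  by rewrite scale0r mul0r sublinear0.
apply/eqP; rewrite eq_le; apply/andP; split; first exact/sp.2/ltW.
rewrite -ler_pdivlMl//; have /(_ t^-1 (t *: x)) := sp.2.
by rewrite scalerA mulVf ?gt_eqF// scale1r; apply; rewrite invr_ge0 ltW.
Qed.

(* The largest sublinear functional below [p] whose value at [- y] is at most
   [- p y]. *)
Definition ray_shift p y x := inf [set p (x + t *: y) - t * p y | t in >= 0].

Lemma ray_shift_le p y t x : sublinear p -> 0 <= t ->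
  ray_shift p y x <= p (x + t *: y) - t * p y.
Proof.
move=> sp t0; apply: ge_inf; last by exists t.
exists (- p (- x)) => _ [s s0 <-]; rewrite -sublinearZ//.
by have := sp.1 (- x) (x + s *: y); rewrite addKr; lra.
Qed.

Lemma le_ray_shift p y x c :
  (forall t, 0 <= t -> c <= p (x + t *: y) - t * p y) -> c <= ray_shift p y x.
Proof.
move=> h; apply: lb_le_inf; last by move=> _ [t t0 <-]; exact: h.
by exists (p (x + 0 *: y) - 0 * p y); exists 0 => //=.
Qed.

(** Parameters [t] for [x] and [s] for [x'] are tested against [t + s] for the sum; under scaling by
    [t > 0], the parameter [s] becomes [t * s]. *)
Lemma ray_shift_sublinear p y : sublinear p -> sublinear (ray_shift p y).
Proof.
move=> sp; split=> [x x'|t x t0].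
  rewrite -lerBlDr; apply: le_ray_shift => t t0.
  rewrite lerBlDl -lerBlDr; apply: le_ray_shift => s s0.
  rewrite lerBlDr (le_trans (ray_shift_le _ _ sp (addr_ge0 t0 s0)))//.
  have := sp.1 (x + t *: y) (x' + s *: y).
  by rewrite addrACA -scalerDl; lra.
move: t0; rewrite le_eqVlt => /predU1P[<-|t0].
  rewrite scale0r mul0r (le_trans (ray_shift_le _ _ sp (lexx 0)))//.
  by rewrite scale0r addr0 sublinear0// mul0r subr0.
rewrite -ler_pdivrMl//; apply: le_ray_shift => s s0.
rewrite ler_pdivrMl// (le_trans (ray_shift_le _ _ sp (mulr_ge0 (ltW t0) s0)))//.
by rewrite -scalerA -scalerDr (sublinearZ _ sp (ltW t0)) mulrBr mulrA.
Qed.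

(** Zorn's lemma for the reversed pointwise order: a non-empty chain is bounded by its pointwise
    infimum, which is finite because every member is at least [- q (- x)] at [x]. *)
Lemma minimal_sublinear q : sublinear q ->
  exists p, [/\ sublinear p, forall x, p x <= q x &
    forall r, sublinear r -> (forall x, r x <= p x) -> r = p].
Proof.
move=> sq.
pose T := {p : V -> R | sublinear p /\ forall x, p x <= q x}.
pose ge (p r : T) := `[< forall x, sval r x <= sval p x >].
have [//|p r s|p r|A tA|p pmin] := @Zorn T ge.
- by move=> p; apply/asboolP.
- by move=> /asboolP pr /asboolP rs; apply/asboolP => x; apply: le_trans (pr x).
- case: p r => [p pq] [r rq] /asboolP/= pr /asboolP/= rp.
  apply/eq_exist/funext => x.
  by apply/eqP; rewrite eq_le rp pr.
- have [A0|/set0P[p0 Ap0]] := eqVneq A set0.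
    by exists (exist _ q (conj sq (fun x => lexx _))) => s; rewrite A0.
  pose m x := inf [set sval p x | p in A].
  have m_le (p : T) x : A p -> m x <= sval p x.
    move=> Ap; apply: ge_inf; last by exists p.
    exists (- q (- x)) => _ [r Ar <-]; have [sr rq] := svalP r.
    by rewrite (le_trans _ (sublinearN x sr))// lerN2.
  have le_m c x : (forall p : T, A p -> c <= sval p x) -> c <= m x.
    move=> h; apply: lb_le_inf; first by exists (sval p0 x); exists p0.
    by move=> _ [p Ap <-]; exact: h.
  have sm : sublinear m.
    split=> [x y|t x].
      rewrite -lerBlDr; apply/le_m => p Ap.
      rewrite lerBlDl -lerBlDr; apply/le_m => r Ar.
      rewrite lerBlDr.
      have [/asboolP pr|/asboolP rp] := tA _ _ Ap Ar.
        rewrite (le_trans (m_le _ _ Ar))// (le_trans ((svalP r).1.1 _ _))//.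
        by have := pr x; lra.
      rewrite (le_trans (m_le _ _ Ap))// (le_trans ((svalP p).1.1 _ _))//.
      by have := rp y; lra.
    rewrite le_eqVlt => /predU1P[<-|t0].
      rewrite scale0r mul0r (le_trans (m_le _ _ Ap0))//.
      by rewrite sublinear0//; exact: (svalP p0).1.
    rewrite -ler_pdivrMl//; apply/le_m => p Ap; rewrite ler_pdivrMl//.
    rewrite (le_trans (m_le _ _ Ap))//.
    by apply: (svalP p).1.2; exact: ltW.
  have mq x : m x <= q x.
    by rewrite (le_trans (m_le _ _ Ap0))//; apply: (svalP p0).2.
  by exists (exist _ m (conj sm mq)) => s As; apply/asboolP => x; exact: m_le.
- exists (sval p); have [sp pq] := svalP p; split=> // r sr rp.
  have rq x : r x <= q x by rewrite (le_trans (rp x)).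
  by rewrite -(pmin (exist _ r (conj sr rq)))//; apply/asboolP.
Qed.

Theorem Hahn_Banach_sublinear q : sublinear q ->
  exists2 f : V -> R^o, linear f & forall x, f x <= q x.
Proof.
move=> /minimal_sublinear[p [sp pq pmin]]; exists p => // a x y.
(* Minimality forces [p = ray_shift p v], and [ray_shift p v u] is at most
   [p (u + v) - p v]. *)
have pD u v : p (u + v) = p u + p v.
  apply/eqP; rewrite eq_le sp.1 /=.
  have pE : ray_shift p v = p.
    apply: pmin => [|z]; first exact: ray_shift_sublinear.
    have := ray_shift_le v z sp (lexx 0).
    by rewrite scale0r addr0 mul0r subr0.
  have := ray_shift_le v u sp (@ler01 R).
  by rewrite pE scale1r mul1r; lra.
have pN u : p (- u) = - p u.
  by apply/eqP; rewrite -addr_eq0 -pD addNr sublinear0.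
rewrite pD; congr (_ + _).
have [a0|a0] := leP 0 a; first exact: sublinearZ.
rewrite -[a]opprK scaleNr pN sublinearZ ?oppr_ge0 ?ltW//.
by rewrite scaleNr.
Qed.

End Sublinear.

(** * Non-zero functionals and norms of elementary tensors *)

Section DualSpace.
Context {R : realType} {V : normedModType R}.
Implicit Types (v : V) (f : dual V).

Lemma norm_sublinear : sublinear (fun v : V => `|v|).
Proof.
by split=> [u v|t v t0]; [exact: ler_normD|rewrite normrZ ger0_norm].
Qed.

(* The ray shift of the norm along [v] is a sublinear minorant of the norm with
   value [- `|v|] at [- v], so a linear functional below it is bounded and
   non-zero. *)
Lemma dual_neq0 v : v != 0 -> exists f, f v != 0.
Proof.
move=> v0.
have [f lf fq] := Hahn_Banach_sublinear (ray_shift_sublinear v norm_sublinear).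
have f_le u : f u <= `|u|.
  rewrite (le_trans (fq u))//.
  rewrite (le_trans (ray_shift_le _ _ norm_sublinear (lexx 0)))//.
  by rewrite scale0r addr0 mul0r subr0.
pose aux := GRing.isLinear.Build R V R^o _ f lf.
pose F : {linear V -> R^o} := HB.pack f aux.
have fN u : f (- u) = - f u by exact: (linearN F).
have cf : continuous f.
  apply: (@bounded_linear_continuous _ _ _ F); apply/bounded_funP => r.
  exists r => u ur; rewrite (le_trans _ ur)// ler_norml f_le andbT.
  by rewrite lerNl -fN -(normrN u) f_le.
have fP : f \in continuous_linear V R^o by rewrite inE.
exists (BoundedOp fP); apply/negP => /eqP /= fv0.
have := fq (- v); rewrite fN fv0 oppr0.
have := ray_shift_le v (- v) norm_sublinear (@ler01 R).
rewrite scale1r mul1r addNr normr0 sub0r.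
by move: v0; rewrite -normr_gt0; lra.
Qed.

Lemma norm_tensor (W : normedModType R) f (x : W) :
  `|tensor f x| = `|f| * `|x|.
Proof.
apply/eqP; rewrite eq_le; apply/andP; split.
  apply: opnorm_le => v v1; rewrite tensorE normrZ ler_wpM2r//.
  exact: opnorm_ub.
have [->|x0] := eqVneq x 0; first by rewrite normr0 mulr0.
have nx : 0 < `|x| by rewrite normr_gt0.
rewrite -ler_pdivlMr//; apply: opnorm_le => v v1.
rewrite ler_pdivlMr// -normrZ.
exact: (opnorm_ub (subnormed_val (tensor f x))).
Qed.

End DualSpace.

Lemma tensorN (R : realType) (V W : normedModType R) (f : dual V) (x : W) :
  tensor (- f) x = - tensor f x.
Proof. by apply/val_inj/val_inj/funext => v; exact: scaleNr. Qed.

Lemma exists_unit_vector (R : realType) (V : normedModType R) :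
  (exists v : V, v != 0) -> exists v : V, `|v| = 1.
Proof.
move=> [v v0]; exists (`|v|^-1 *: v).
by rewrite normrZ normfV normr_id mulVf// normr_eq0.
Qed.

(** * Almost squareness of spaces of compact operators *)

Section AlmostSquare.
Context {R : realType}.

(** With [c = p + q] and [a = p - q], the vector is [p (u + y) + q (u - y)], and [|p| + |q|] is the
    maximum of [|c|] and [|a|]. *)
Lemma norm_scale_addr_le (V : normedModType R) (u y : V) (c a m : R) :
  `|c| <= 1 -> `|a| <= 1 -> `|u + y| <= m -> `|u - y| <= m ->
  `|c *: u + a *: y| <= m.
Proof.
have [p [q [-> ->]]] : exists p q, c = p + q /\ a = p - q.
  by exists ((c + a) / 2), ((c - a) / 2); lra.
move=> c1 a1 um up; have pq1 : `|p| + `|q| <= 1.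
  move: c1 a1; rewrite !ler_norml => /andP[c1 c2] /andP[a1 a2].
  by case: (ler0P p); case: (ler0P q); lra.
have -> : (p + q) *: u + (p - q) *: y = p *: (u + y) + q *: (u - y).
  by rewrite !scalerDr addrACA !scalerDl scalerN scaleNr.
rewrite (le_trans (ler_normD _ _))// !normrZ.
rewrite (@le_trans _ _ ((`|p| + `|q|) * m))//.
  by rewrite mulrDl lerD// ler_wpM2l.
by rewrite -[leRHS]mul1r ler_wpM2r// (le_trans _ um).
Qed.

Lemma almost_square_ball (X : normedModType R) (s : seq X) (e : R) :
  (exists x : X, x != 0) -> almost_square X -> 0 < e ->
  (forall x, x \in s -> `|x| <= 1) ->
  exists y : X, [/\ `|y| <= 1, 1 - e <= `|y| &
    forall x a, x \in s -> `|a| <= 1 -> `|x + a *: y| <= 1 + e].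
Proof.
move=> /exists_unit_vector[x0 nx0] Xasq e0 s1.
(* Almost squareness concerns unit vectors, so each point is written as its norm times a unit
   vector; for a zero point any unit vector will do. *)
pose u (i : 'I_(size s)) :=
  if s`_i == 0 then x0 else `|s`_i|^-1 *: s`_i.
have uE (i : 'I_(size s)) : s`_i = `|s`_i| *: u i.
  rewrite /u; case: ifPn => [/eqP ->|si0]; first by rewrite normr0 scale0r.
  by rewrite scalerA divff ?normr_eq0// scale1r.
have u1 i : `|u i| = 1.
  rewrite /u; case: ifPn => // si0.
  by rewrite normrZ normfV normr_id mulVf// normr_eq0.
have [y [y1 ylim ulim]] := Xasq _ u u1.
have lt1 : 1 < 1 + e by rewrite ltrDl.
have lt2 : 1 - e < 1 by rewrite ltrBlDr ltrDl.
have /(@filter_ex _ \oo)[n [yn un]] : \forall n \near \oo, 1 - e <= `|y n| /\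
    forall i, `|u i + y n| <= 1 + e /\ `|u i - y n| <= 1 + e.
  apply: filterI; first exact: cvgr_ge ylim _ lt2.
  apply: (@filter_forall _ 'I_(size s) (fun i n =>
    `|u i + y n| <= 1 + e /\ `|u i - y n| <= 1 + e) \oo _) => i.
  have [up um] := ulim i.
  by apply: filterI; [exact: cvgr_le up _ lt1|exact: cvgr_le um _ lt1].
exists (y n); split=> // x a xs a1.
have xs' : (index x s < size s)%N by rewrite index_mem.
have := uE (Ordinal xs'); rewrite /= nth_index// => ->.
have [up um] := un (Ordinal xs').
by apply: norm_scale_addr_le => //; rewrite normr_id; exact: s1.
Qed.

(** Balls of radius [e] centred in [A] already cover the closure of [A]; the net consists of the
    centres of a finite subcover. *)
Lemma precompact_net (X : normedModType R) (A : set X) (e : R) :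
  precompact A -> 0 < e ->
  exists s : seq X, {subset s <= A} /\
    forall x, A x -> exists2 z, z \in s & `|z - x| < e.
Proof.
rewrite precompactE compact_cover => cA e0.
have [x _|x Ax|D DA AD] := cA X A (fun x => ball x e).
- exact: ball_open.
- have [z [Az xz]] := Ax _ (nbhsx_ballx x e e0).
  by exists z => //; exact: ball_sym.
- exists (finmap.enum_fset D); split=> [x xD|x Ax]; first exact: DA.
  have [z zD zx] := AD _ (subset_closure Ax).
  by exists z => //; move: zx; rewrite -ball_normE.
Qed.

(** The nets of the [k] images are concatenated; their points are values of the [T i] on the unit
    ball, hence of norm at most 1. *)
Lemma compact_op_net (V X : normedModType R) k (T : 'I_k -> compact_op V X)
    (e : R) : (forall i, `|T i| <= 1) -> 0 < e ->
  exists s : seq X, (forall x, x \in s -> `|x| <= 1) /\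
    forall i v, `|v| <= 1 ->
    exists2 z, z \in s & `|z - subnormed_val (T i) v| < e.
Proof.
move=> T1 e0.
have net i : exists s : seq X,
    {subset s <= subnormed_val (T i) @` unit_ball V} /\
    forall x, (subnormed_val (T i) @` unit_ball V) x ->
      exists2 z, z \in s & `|z - x| < e.
  apply: precompact_net => //.
  by have := subnormed_valP (T i); rewrite inE.
have [S SP] := choice net.
exists (flatten [seq S i | i <- enum 'I_k]); split.
  move=> x /flatten_mapP[i _ /(SP i).1]; rewrite inE => -[v v1 <-].
  by rewrite (le_trans _ (T1 i))//; exact: opnorm_ub.
move=> i v v1.
have [|z zS zv] := (SP i).2 (subnormed_val (T i) v); first by exists v.
by exists z => //; apply/flatten_mapP; exists i => //; rewrite mem_enum.
Qed.

Lemma norm_add_tensor_le (V X : normedModType R) (T : compact_op V X)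
    (g : dual V) (y : X) (m : R) :
  (forall v, `|v| <= 1 -> `|subnormed_val T v + g v *: y| <= m) ->
  `|T + tensor g y| <= m.
Proof. by move=> Tm; apply: opnorm_le => v v1; exact: Tm. Qed.

(** Common core of (i) and (ii): [V] is [Y] or its dual, and [g] is a unit functional or an
    evaluation of norm 1. *)
Lemma almost_square_compact_op (V X : normedModType R) (g : dual V)
    (H : submodClosed (compact_op V X)) :
  (exists x : X, x != 0) -> almost_square X -> `|g| = 1 ->
  (forall x : X, tensor g x \in H) -> almost_square (subnormed H).
Proof.
move=> X0 Xasq g1 gH k T T1.
have step (e : R) : 0 < e -> exists S : subnormed H,
    [/\ `|S| <= 1, 1 - e <= `|S| & forall i,
       `|1 - `|T i + S| | <= e /\ `|1 - `|T i - S| | <= e].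
  move=> e0; have e20 : 0 < e / 2 by rewrite divr_gt0.
  have T1' i : `|subnormed_val (T i)| <= 1 by rewrite -norm_subnormed T1.
  have [s [s1 sT]] := compact_op_net T1' e20.
  have [y [y1 ye ys]] := almost_square_ball X0 Xasq e20 s1.
  pose S : subnormed H := SubNormed (gH y).
  have nS : `|S| = `|y| by rewrite norm_subnormed norm_tensor g1 mul1r.
  (* The cases [b = 1] and [b = -1] give the bounds for [T i + S] and [T i - S]. *)
  have up i b : `|b| <= 1 ->
      `|subnormed_val (T i) + tensor (b *: g) y| <= 1 + e.
    move=> b1; apply: norm_add_tensor_le => v v1.
    have [z zs zT] := sT i v v1.
    set w := (X in `|X + _|).
    (* The net error [w - z] costs [e / 2], and [z] plus the multiple of [y] has norm at most
       [1 + e / 2]. *)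
    rewrite -(subrK z w) -addrA (le_trans (ler_normD _ _))// (distrC w).
    have gv1 : `|b * g v| <= 1.
      rewrite normrM mulr_ile1//.
      by rewrite -g1; exact: opnorm_ub.
    by have := ys _ _ zs gv1; rewrite bounded_opZ; lra.
  have upD i : `|T i + S| <= 1 + e.
    have := up i 1; rewrite normr1 scale1r; exact.
  have upB i : `|T i - S| <= 1 + e.
    rewrite norm_subnormed linearB /= -tensorN.
    by have := up i (-1); rewrite normrN1 scaleN1r; apply.
  have sum i : 2 <= `|T i + S| + `|T i - S|.
    have <- : `|T i *+ 2| = 2 by rewrite normrMn T1.
    by rewrite (le_trans _ (ler_normD _ _))// addrACA subrr addr0 mulr2n.
  exists S; rewrite nS; split=> //; first by lra.
  move=> i; have := upD i; have := upB i; have := sum i.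
  by rewrite !ler_norml; lra.
have [S SP] := choice (fun n => step n.+1%:R^-1 (@harmonic_gt0 R n)).
have cvg1 (u : nat -> R) : (forall n, `|1 - u n| <= n.+1%:R^-1) ->
    u n @[n --> \oo] --> (1 : R).
  move=> ule; apply/cvgrPdist_le => e e0.
  near=> n; rewrite (le_trans (ule n))//; near: n.
  exact: cvgr_le (@cvg_harmonic R) _ e0.
exists S; split=> [n||i].
- by have [] := SP n.
- apply: (cvg1 (fun n => `|S n|)) => n.
  have [Sn1 Sn _] := SP n.
  by rewrite ger0_norm ?subr_ge0// lerBlDr -lerBlDl.
- split; [apply: (cvg1 (fun n => `|T i + S n|)) => n|
          apply: (cvg1 (fun n => `|T i - S n|)) => n];
  by have [_ _ /(_ i)[]] := SP n.
Unshelve. all: end_near. Qed.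

End AlmostSquare.

Theorem theorem2p6 (R : realType) (X Y : completeNormedModType R)
    (X_neq0 : exists x : X, x != 0) (Y_neq0 : exists y : Y, y != 0)
    (X_asq : almost_square X) :
  (forall H : submodClosed (compact_op Y X),
     closed [set T : compact_op Y X | T \in H] ->
     dual_tensor_product Y X `<=` [set T : compact_op Y X | T \in H] ->
     almost_square (subnormed H)) /\
  (forall H : submodClosed (compact_op (dual Y) X),
     closed [set T : compact_op (dual Y) X | T \in H] ->
     tensor_product Y X `<=` [set T : compact_op (dual Y) X | T \in H] ->
     almost_square (subnormed H)).
Proof.
have [y y0] := Y_neq0; have [f fy] := dual_neq0 y0.
split=> H _ HT.
  have [|g g1] := @exists_unit_vector R (dual Y).
    by exists f; apply: contra_neq fy => ->.
  apply: (almost_square_compact_op X_neq0 X_asq g1) => x; apply: HT.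
  by exists 1%N, (fun=> g), (fun=> x); rewrite big_ord1.
have ev0 : 0 < `|evaluation y|.
  rewrite normr_gt0; apply: contra_neq fy => ev0.
  by rewrite -evaluationE ev0.
(* [HT] provides tensors with evaluations only, so the normalisation is carried out on [y] inside
   [evaluation]. *)
have evZ : evaluation (`|evaluation y|^-1 *: y) =
    `|evaluation y|^-1 *: evaluation y.
  by apply/val_inj/funext => h; rewrite /= /evaluation_fun linearZ.
have g1 : `|evaluation (`|evaluation y|^-1 *: y)| = 1.
  by rewrite evZ normrZ normfV normr_id mulVf// gt_eqF.
apply: (almost_square_compact_op X_neq0 X_asq g1) => x; apply: HT.
exists 1%N, (fun=> `|evaluation y|^-1 *: y), (fun=> x).
by rewrite big_ord1.
Qed.
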